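(* Let $\varkappa\geq 2$ be an integer. Let $\{a_n\}_{n=0}^\infty$ be a determinate Stieltjes moment sequence with representing measure $\mu$, and suppose that $\{\sqrt[\varkappa]{a_n}\}_{n=0}^\infty$ is a Stieltjes moment sequence with a representing measure $\nu$. Then $$\operatorname{supp}\mu=\overline{\pi_\varkappa\big((\operatorname{supp}\nu)^\varkappa\big)}.$$ Moreover, if $\operatorname{supp}\nu$ is compact or $0\notin\operatorname{supp}\nu$, then $\operatorname{supp}\mu=\pi_\varkappa\big((\operatorname{supp}\nu)^\varkappa\big)$.
   Context: $\mathbb{R}_+=[0,\infty)$. A sequence $\{a_n\}_{n=0}^\infty\subseteq\mathbb{R}_+$ is a Stieltjes moment sequence if there is a positive Borel measure $\mu$ on $\mathbb{R}_+$ with $a_n=\int_{\mathbb{R}_+}x^n\,d\mu(x)$ for all integers $n\geq 0$ (with $x^0=1$); such $\mu$ is called a representing measure of $\{a_n\}_{n=0}^\infty$. The sequence is determinate if it has a unique representing measure. $\operatorname{supp}$ denotes the closed support of a measure. For a set $X$, $X^\varkappa$ is the $\varkappa$-fold Cartesian product. The map $\pi_\varkappa\colon\mathbb{R}_+^\varkappa\to\mathbb{R}_+$ is $\pi_\varkappa(x_1,\ldots,x_\varkappa)=x_1\cdots x_\varkappa$. The closure is taken in $\mathbb{R}_+$. *)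

(* Defs.v *)
From mathcomp Require Import all_boot all_order all_algebra.
From mathcomp Require Import all_classical all_reals all_analysis.
Set Implicit Arguments.
Unset Strict Implicit.
Unset Printing Implicit Defensive.
Import Order.TTheory GRing.Theory Num.Theory.
Import numFieldNormedType.Exports.
Local Open Scope classical_set_scope.
Local Open Scope ring_scope.

(* A Borel measure on [0, +oo[ is encoded as a Borel measure on the line that
   vanishes on the negative half-line.  As [0, +oo[ is closed, supports and
   closures are the same in [0, +oo[ and in R. *)
Definition representing_measure (R : realType)
    (mu : {measure set (measurableTypeR R) -> \bar R}) (a : nat -> R) : Prop :=
  mu `]-oo, 0%R[%classic = 0%E /\
  forall n : nat, (\int[mu]_(x in `[0%R, +oo[) (x ^+ n)%:E = (a n)%:E)%E.

Definition Stieltjes_moment_sequence (R : realType) (a : nat -> R) : Prop :=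
  (forall n, 0 <= a n) /\
  exists mu : {measure set (measurableTypeR R) -> \bar R},
    representing_measure mu a.

(* A MathComp-Analysis measure is a function on all subsets, constrained only
   on the measurable ones; uniqueness is therefore equality on Borel sets. *)
Definition determinate (R : realType) (a : nat -> R) : Prop :=
  Stieltjes_moment_sequence a /\
  forall mu1 mu2 : {measure set (measurableTypeR R) -> \bar R},
    representing_measure mu1 a -> representing_measure mu2 a ->
    forall A : set (measurableTypeR R), measurable A -> mu1 A = mu2 A.

Definition supp (R : realType)
    (mu : {measure set (measurableTypeR R) -> \bar R}) : set R :=
  [set x | forall U : set R, open U -> U x -> (0 < mu U)%E].

Definition cartesian_power (T : Type) (k : nat) (X : set T) : set ('I_k -> T) :=
  [set x | forall i, X (x i)].

Definition coord_prod (R : realType) (k : nat) (x : 'I_k -> R) : R :=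
  \prod_(i < k) x i.

(* Main.v *)
Require Import Defs.
From HB Require Import structures.
From mathcomp Require Import all_boot all_order all_algebra.
From mathcomp Require Import all_classical all_reals all_analysis.
From mathcomp Require Import measurable_realfun.
Import Order.TTheory GRing.Theory Num.Theory.
Import numFieldNormedType.Exports.
Set Implicit Arguments.
Unset Strict Implicit.
Unset Printing Implicit Defensive.
Local Open Scope classical_set_scope.
Local Open Scope ring_scope.

(** The image of the [k]-fold product measure of [nu] under the
    map that multiplies all coordinates has for [n]-th moment the [k]-th power of
    the [n]-th moment of [nu], by Tonelli, that is [a n].  As [a] is determinate, this
    image measure coincides with [mu] on Borel sets, hence has the same support,
    and what remains is to compute the support of the image.

    The image measure is built one factor at a time: [mulconv m1 m2] is the
    multiplicative convolution of [m1] and [m2], the image of [m1 \x m2] under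
    multiplication, and [mulconv_exp nu k] iterates it from the Dirac measure
    at [1].  The moments multiply ([representing_mulconv]), and the support of a
    convolution is the closure of the product of the supports
    ([supp_mulconv]): a rectangle of neighbourhoods of two points of the supports
    has positive mass, and conversely an open set that misses all products pulls
    back to a set that avoids [supp m1 `*` supp m2], whose complement is null
    because the complement of a support is null ([measure_setC_supp]).
    Induction on [k] then yields the first claim, as the closures taken at each
    stage are absorbed by the last one ([closure_mulset]).

    For the second claim, the set of [k]-fold products is shown to be closed.
    If [supp nu] is compact, the set of products is compact.  If [supp nu] omits
    [0] then, being closed and contained in the nonnegative half-line, it is
    bounded below by some [d > 0]; a product of two elements that are bounded
    away from [0] can only stay bounded if both factors do, so that locally the
    set of products is the image of a compact set ([closed_mulset]). *)

(** * Supports of Borel measures on the line *)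

Section supp.
Context (R : realType).
Implicit Types m : {measure set (measurableTypeR R) -> \bar R}.

Lemma closed_supp m : closed (supp m).
Proof.
move=> x clx U oU Ux; have [y [sy Uy]] := clx U (open_nbhs_nbhs (conj oU Ux)).
exact: sy.
Qed.

(** Each point outside the support lies in a null ball with rational centre and
    radius, and there are countably many such balls. *)
Lemma measure_setC_supp m : m (~` supp m) = 0%E.
Proof.
have mS : measurable (~` supp m : set (measurableTypeR R)).
  by apply: open_measurable; apply: closed_openC; exact: closed_supp.
pose B (p : rat * rat) : set R := ball (ratr p.1 : R) (ratr p.2).
have mB p : measurable (B p : set (measurableTypeR R)).
  exact: measurable_ball.
pose F n : set (measurableTypeR R) :=
  if unpickle n is Some p then if m (B p) == 0%E then B p else set0 else set0.
apply: measure_negligible => //; apply: (@negligibleS _ _ _ m (\bigcup_n F n)).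
  move=> x /existsNP[U /not_implyP[oU /not_implyP[Ux mU]]].
  have [c [r [xB BU]]] := open_subball_rat oU (mem_set Ux).
  have mB0 : m (B (c, r)) = 0%E.
    apply/eqP; rewrite -measure_le0.
    apply: le_trans (_ : m U <= 0)%E; last by rewrite leNgt; exact/negP.
    apply: le_measure => //; rewrite inE; first exact: mB (c, r).
    exact: open_measurable.
  exists (pickle (c, r)); first exact: I.
  by rewrite /F pickleK mB0 eqxx; exact: set_mem.
apply: negligible_bigcup => n; rewrite /F; case: unpickle => [p|].
  by case: ifPn => [/eqP ?|_]; apply/negligibleP => //; rewrite measure0.
by apply/negligibleP.
Qed.

Lemma supp_nonneg m :
  m `]-oo, 0%R[%classic = 0%E <-> supp m `<=` [set x | 0 <= x].
Proof.
split=> [m0 x sx|sm].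
  rewrite /= leNgt; apply/negP => x0.
  suff : (0 < m `]-oo, 0%R[%classic)%E by rewrite m0 ltxx.
  by apply: sx; [exact: interval_open|rewrite /= in_itv].
apply/eqP; rewrite -measure_le0 -(measure_setC_supp m).
apply: le_measure; rewrite ?inE //.
  by apply: open_measurable; apply: closed_openC; exact: closed_supp.
by move=> x /=; rewrite in_itv/= => x0 /sm /=; rewrite leNgt x0.
Qed.

Lemma eq_supp m1 m2 : (forall U : set R, open U -> m1 U = m2 U) ->
  supp m1 = supp m2.
Proof.
by move=> eqm; apply/seteqP; split=> x sx U oU Ux;
  [rewrite -eqm|rewrite eqm] => //; exact: sx.
Qed.

Lemma supp_dirac (x : measurableTypeR R) : supp (\d_x) = [set (x : R)].
Proof.
apply/seteqP; split=> [y sy|_ -> U oU Ux]; last first.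
  by rewrite /= diracE mem_set.
apply: contrapT => yx.
suff : (0 < (\d_x (~` [set x]) : \bar R))%E.
  by rewrite diracE memNset ?ltxx// => /(_ erefl).
by apply: sy => //; apply: closed_openC; exact: closed_eq.
Qed.

(** Moments are rewritten with absolute values so as to be integrals of
    nonnegative multiplicative functions over the whole line, to which Tonelli's
    theorem applies without tracking the signs of the factors. *)
Lemma integral_exprn_normr m n : m `]-oo, 0%R[%classic = 0%E ->
  (\int[m]_(x in `[0%R, +oo[) (x ^+ n)%:E = \int[m]_x (`|x| ^+ n)%:E)%E.
Proof.
move=> m0; rewrite [RHS](@ge0_negligible_integral _ _ _ _ setT
  (`]-oo, 0%R[%classic : set (measurableTypeR R))) //.
- rewrite setTD setCitvl; apply: eq_integral => x.
  by rewrite inE/= in_itv/= andbT => x0; rewrite ger0_norm.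
- by apply/measurable_EFinP; apply: measurable_funX; exact: normr_measurable.
Qed.

End supp.

(** * Products of sets of real numbers *)

Section mulset.
Context (R : realType).
Implicit Types A B S : set R.

Definition mulset A B : set R := (fun z : R * R => z.1 * z.2) @` (A `*` B).

Lemma mulsetS A A' B B' : A `<=` A' -> B `<=` B' ->
  mulset A B `<=` mulset A' B'.
Proof. by move=> AA' BB' _ [p [/AA' ? /BB' ?] <-]; exists p. Qed.

Lemma mulset_closure A B :
  mulset (closure A) (closure B) `<=` closure (mulset A B).
Proof.
move=> _ [[x y] [/= clx cly] <-] U /= Uxy.
have [[V W] [/= Vx Wy] VWU] := @mul_continuous R (x, y) U Uxy.
have [a [Aa Va]] := clx V Vx; have [b [Bb Wb]] := cly W Wy.
exists (a * b); split; first by exists (a, b).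
exact: (VWU (a, b)).
Qed.

Lemma closure_mulset A B :
  closure (mulset (closure A) B) = closure (mulset A B).
Proof.
apply/seteqP; split; last first.
  by apply: closureS; apply: mulsetS => //; exact: subset_closure.
rewrite [X in _ `<=` X](_ : _ = closure (closure (mulset A B))).
  apply: closureS; apply: subset_trans (@mulset_closure A B).
  by apply: mulsetS => //; exact: subset_closure.
exact/closure_id/closed_closure.
Qed.

Lemma compact_mulset A B : compact A -> compact B -> compact (mulset A B).
Proof.
move=> cA cB; apply: continuous_compact; last exact: compact_setX.
by apply: continuous_subspaceT; exact: mul_continuous.
Qed.

(** A lower bound on one factor turns an upper bound on the product into an upper
    bound on the other factor, so near a limit point the products come from two
    compact sets.  Without positive lower bounds the conclusion fails: the
    product of the natural numbers and of the inverses of positive integers,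
    together with [0], is the set of nonnegative rational numbers. *)
Lemma closed_mulset A B (d e : R) : 0 < d -> 0 < e ->
  closed A -> A `<=` [set x | d <= x] -> closed B -> B `<=` [set x | e <= x] ->
  closed (mulset A B).
Proof.
move=> d0 e0 cA Ad cB Be z clz.
(* any bound beyond z will do: products close to z are smaller than M *)
pose M := z + 1.
pose A' := A `&` `[d, M / e]; pose B' := B `&` `[e, M / d].
have cC : closed (mulset A' B').
  apply: compact_closed => //; apply: compact_mulset.
  - apply: (subclosed_compact _ (@segment_compact _ d (M / e))) => //.
      by apply: closedI => //; exact: interval_closed.
    exact: subIsetr.
  - apply: (subclosed_compact _ (@segment_compact _ e (M / d))) => //.
      by apply: closedI => //; exact: interval_closed.
    exact: subIsetr.
suff : closure (mulset A' B') z.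
  by move/cC => [] w [] [? _] [? _] <-; exists w.
move=> U Uz.
have Mz : nbhs z `]-oo, M[%classic.
  by apply: open_nbhs_nbhs; split; [exact: interval_open|
    rewrite /= in_itv/= ltrDl].
have [_ [[[x y] [/= Ax By] <-] [Uxy]]] := clz _ (filterI Uz Mz).
rewrite /= in_itv/= => /ltW xyM.
exists (x * y); split => //; exists (x, y) => //.
have /= dx := Ad _ Ax; have /= ey := Be _ By.
split; split => //=; rewrite in_itv/= ?dx ?ey /=.
  rewrite ler_pdivlMr//; apply: le_trans xyM; apply: ler_wpM2l => //.
  exact: le_trans (ltW d0) dx.
rewrite ler_pdivlMr// mulrC; apply: le_trans xyM; apply: ler_wpM2r => //.
exact: le_trans (ltW e0) ey.
Qed.

Lemma coord_prod0 S : @coord_prod R 0 @` @cartesian_power R 0 S = [set 1].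
Proof.
apply/seteqP; split=> [_ [x _ <-]|_ ->]; first by rewrite /coord_prod big_ord0.
by exists (fun=> 1); [case|rewrite /coord_prod big_ord0].
Qed.

Lemma coord_prodS k S : @coord_prod R k.+1 @` @cartesian_power R k.+1 S =
  mulset (@coord_prod R k @` @cartesian_power R k S) S.
Proof.
apply/seteqP; split=> [_ [x Sx <-]|_ [[_ y] /= [[x Sx <-] Sy] <-]].
  rewrite /coord_prod big_ord_recr /=.
  exists (\prod_(i < k) x (widen_ord (leqnSn k) i), x ord_max) => //.
  by split; [exists (x \o widen_ord (leqnSn k)) => // i; exact: Sx|exact: Sx].
exists (fun i => oapp x y (unlift ord_max i)).
  by move=> i /=; case: unliftP => [j|] _ /=.
rewrite /coord_prod big_ord_recr /= unlift_none /=; congr (_ * _).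
apply: eq_bigr => i _.
by rewrite (_ : widen_ord _ _ = lift ord_max i) ?liftK//; apply: ord_inj;
  rewrite lift_max.
Qed.

Lemma compact_coord_prod k S : compact S ->
  compact (@coord_prod R k @` @cartesian_power R k S).
Proof.
move=> cS; elim: k => [|k IHk]; first by rewrite coord_prod0; exact: compact_set1.
by rewrite coord_prodS; exact: compact_mulset.
Qed.

Lemma coord_prod_ge k S (d : R) : 0 < d -> S `<=` [set x | d <= x] ->
  @coord_prod R k @` @cartesian_power R k S `<=` [set x | d ^+ k <= x].
Proof.
move=> d0 Sd _ [x Sx <-] /=; rewrite /coord_prod.
rewrite -[k in d ^+ k]card_ord -prodr_const.
by apply: ler_prod => i _; rewrite (ltW d0) /=; exact: Sd.
Qed.

Lemma closed_coord_prod k S (d : R) : 0 < d -> closed S ->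
  S `<=` [set x | d <= x] -> closed (@coord_prod R k @` @cartesian_power R k S).
Proof.
move=> d0 cS Sd; elim: k => [|k IHk].
  by rewrite coord_prod0; exact: closed_eq.
rewrite coord_prodS; apply: (@closed_mulset _ _ (d ^+ k) d) => //.
  exact: exprn_gt0.
exact: coord_prod_ge.
Qed.

End mulset.

(** * Multiplicative convolution of finite measures *)

Definition mul_pair (R : realType)
    (z : measurableTypeR R * measurableTypeR R) : measurableTypeR R :=
  (z.1 : R) * (z.2 : R).
Arguments mul_pair : clear implicits.

Section mulconv.
Context (R : realType).
Local Notation T := (measurableTypeR R).

Lemma measurable_mul_pair : measurable_fun [set: T * T] (mul_pair R).
Proof. exact: (@measurable_funM _ (T * T)%type R setT fst snd). Qed.

HB.instance Definition _ :=
  isMeasurableFun.Build _ _ _ _ (mul_pair R) measurable_mul_pair.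

Definition mulconv (m1 m2 : {finite_measure set T -> \bar R}) : set T -> \bar R :=
  pushforward (m1 \x m2)%E (mul_pair R).

Context (m1 m2 : {finite_measure set T -> \bar R}).

Let mulconv0 : mulconv m1 m2 set0 = 0%E.
Proof. exact: measure0. Qed.

Let mulconv_ge0 A : (0 <= mulconv m1 m2 A)%E.
Proof. exact: measure_ge0. Qed.

Let mulconv_sigma_additive : semi_sigma_additive (mulconv m1 m2).
Proof.
exact: (@measure_semi_sigma_additive _ _ _
  (pushforward (m1 \x m2)%E (mul_pair R))).
Qed.

HB.instance Definition _ := isMeasure.Build _ _ _ (mulconv m1 m2)
  mulconv0 mulconv_ge0 mulconv_sigma_additive.

Let mulconv_fin : fin_num_fun (mulconv m1 m2).
Proof.
apply: lty_fin_num_fun.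
rewrite /= /mulconv /pushforward preimage_setT -setXTT product_measure1E//.
by rewrite lte_mul_pinfty// -?ge0_fin_numE// fin_num_measure.
Qed.

HB.instance Definition _ :=
  Measure_isFinite.Build _ _ _ (mulconv m1 m2) mulconv_fin.

End mulconv.

Fixpoint mulconv_exp (R : realType)
    (m : {finite_measure set (measurableTypeR R) -> \bar R}) k :
    {finite_measure set (measurableTypeR R) -> \bar R} :=
  if k is k'.+1 then mulconv (mulconv_exp m k') m
  else \d_((1 : R) : measurableTypeR R).

Section mulconv_theory.
Context (R : realType).
Local Notation T := (measurableTypeR R).
Implicit Types m : {finite_measure set T -> \bar R}.

Lemma integral_mulconv_normr m1 m2 n :
  (\int[mulconv m1 m2]_x (`|x| ^+ n)%:E =
   \int[m1]_x (`|x| ^+ n)%:E * \int[m2]_x (`|x| ^+ n)%:E)%E.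
Proof.
have mn : measurable_fun [set: T] (fun x : T => (`|x : R| ^+ n)%:E).
  by apply/measurable_EFinP; apply: measurable_funX; exact: normr_measurable.
rewrite [LHS](@ge0_integral_pushforward _ _ _ _ _ _
  (@measurable_mul_pair R) _ setT)//.
rewrite preimage_setT fubini_tonelli1//=; last 1 first.
  exact: (measurableT_comp mn (@measurable_mul_pair R)).
rewrite /fubini_F /= /mul_pair /=.
under eq_integral => x _.
  under eq_integral => y _ do rewrite normrM exprMn EFinM.
  rewrite ge0_integralZl//.
  over.
by rewrite ge0_integralZr// integral_ge0.
Qed.

(** An open set [~` S] disjoint from the products is null, because its preimage
    under multiplication lies in the null set of the pairs with a coordinate
    outside the corresponding support. *)
Lemma supp_mulconv m1 m2 :
  supp (mulconv m1 m2) = closure (mulset (supp m1) (supp m2)).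
Proof.
apply/seteqP; split=> [z sz|].
  apply: contrapT => /= nclz.
  set S := closure _ in nclz.
  have oC : open (~` S) by apply: closed_openC; exact: closed_closure.
  suff : (mulconv m1 m2 (~` S) <= 0)%E.
    by rewrite leNgt => /negP; apply; exact: sz.
  pose N1 : set T := ~` supp m1; pose N2 : set T := ~` supp m2.
  have mN1 : measurable N1.
    by apply: open_measurable; apply: closed_openC; exact: closed_supp.
  have mN2 : measurable N2.
    by apply: open_measurable; apply: closed_openC; exact: closed_supp.
  rewrite /mulconv /pushforward.
  have N1T0 : ((m1 \x m2)%E (N1 `*` setT) <= 0)%E.
    by rewrite product_measure1E// (measure_setC_supp m1) mul0e.
  have N2T0 : ((m1 \x m2)%E (setT `*` N2) <= 0)%E.
    by rewrite product_measure1E// (measure_setC_supp m2) mule0.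
  apply: (@le_trans _ _ ((m1 \x m2)%E ((N1 `*` setT) `|` (setT `*` N2)))).
    apply: le_measure; rewrite ?inE.
    - rewrite -[X in measurable X]setTI; apply: measurable_mul_pair => //.
      exact: open_measurable.
    - by apply: measurableU; exact: measurableX.
    move=> [x y] /= Sxy; apply: contrapT => /not_orP[/= nx ny].
    apply: Sxy; apply: subset_closure; exists (x, y) => //; split => /=.
      by apply: contrapT => ?; apply: nx.
    by apply: contrapT => ?; apply: ny.
  have mN1T : measurable (N1 `*` [set: T]) by exact: measurableX.
  have mTN2 : measurable ([set: T] `*` N2) by exact: measurableX.
  apply: (le_trans (measureU2 _ mN1T mTN2)).
  by rewrite -[leRHS]adde0; exact: leeD.
suff H : mulset (supp m1) (supp m2) `<=` supp (mulconv m1 m2).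
  move/closureS: H => /subset_trans; apply; exact: closed_supp.
move=> _ [[x y] [/= sx sy] <-] U oU Uxy.
have [[V W] [/= Vx Wy] VWU] :=
  @mul_continuous R (x, y) U (open_nbhs_nbhs (conj oU Uxy)).
move: Vx Wy; rewrite !nbhsE => -[V' [oV' V'x] V'V] [W' [oW' W'y] W'W].
apply: (@lt_le_trans _ _ ((m1 \x m2)%E (V' `*` W'))).
  rewrite product_measure1E; [|exact: open_measurable..].
  by apply: mule_gt0; [exact: sx|exact: sy].
apply: le_measure; rewrite ?inE.
- by apply: measurableX; exact: open_measurable.
- rewrite -[X in measurable X]setTI; apply: measurable_mul_pair => //.
  exact: open_measurable.
by move=> [a b] [/= /V'V Va /W'W Wb]; exact: (VWU (a, b)).
Qed.

Lemma representing_mulconv m1 m2 (a b : nat -> R) :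
  representing_measure m1 a -> representing_measure m2 b ->
  representing_measure (mulconv m1 m2) (fun n => a n * b n).
Proof.
move=> [m10 ma] [m20 mb].
have m0 : mulconv m1 m2 `]-oo, 0%R[%classic = 0%E.
  apply/supp_nonneg; rewrite supp_mulconv.
  have cge : closed [set x : R | 0 <= x] by exact: closed_ge.
  apply: subset_trans cge; apply: closureS.
  move/supp_nonneg in m10; move/supp_nonneg in m20.
  by move=> _ [[x y] [/= /m10 x0 /m20 y0] <-]; exact: mulr_ge0.
split=> // n; rewrite integral_exprn_normr// integral_mulconv_normr.
by rewrite -!integral_exprn_normr// ma mb.
Qed.

Lemma representing_mulconv_exp m (b : nat -> R) k :
  representing_measure m b ->
  representing_measure (mulconv_exp m k) (fun n => b n ^+ k).
Proof.
move=> mb; elim: k => [|k IHk] /=; last first.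
  under eq_fun do rewrite exprSr.
  exact: representing_mulconv.
split=> [|n].
  by rewrite /= diracE memNset //= in_itv /= ltr10.
rewrite integral_dirac//; last first.
  by apply/measurable_EFinP; exact: exprn_measurable.
by rewrite diracE mem_set ?mul1e ?expr1n ?expr0 //= in_itv /= ler01.
Qed.

Lemma supp_mulconv_exp m k : supp (mulconv_exp m k) =
  closure (@coord_prod R k @` @cartesian_power R k (supp m)).
Proof.
elim: k => [|k IHk] /=.
  by rewrite supp_dirac coord_prod0; apply/closure_id; exact: closed_eq.
by rewrite supp_mulconv IHk closure_mulset coord_prodS.
Qed.

End mulconv_theory.

(** * Supports of representing measures *)

(** [mulconv] takes bundled finite measures, whereas the finiteness of a
    representing measure is a consequence of its moment of order [0]. *)
Lemma finite_measure_ex (d : measure_display) (T : measurableType d)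
    (R : realType) (m : {measure set T -> \bar R}) : (m setT < +oo)%E ->
  exists m' : {finite_measure set T -> \bar R}, m = m'.
Proof.
move=> /lty_fin_num_fun mfin.
have msig : sigma_finite setT m.
  by apply: fin_num_fun_sigma_finite => //; rewrite measure0.
pose h1 := isFinite.Build _ _ _ _ mfin.
pose h2 := isSFinite.Build _ _ _ _ (sfinite_measure_sigma_finite msig).
pose h3 := isSigmaFinite.Build _ _ _ _ msig.
pose m' := HB.pack_for (FiniteMeasure.type T R) (Measure.sort m) h1 h2 h3.
by exists m'; apply: eq_measure.
Qed.

Lemma representing_measure_lty (R : realType) (a : nat -> R)
    (m : {measure set (measurableTypeR R) -> \bar R}) :
  representing_measure m a -> (m setT < +oo)%E.
Proof.
move=> [mneg /(_ 0)]; under eq_integral do rewrite expr0.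
rewrite integral_cst//= mul1e => m0.
rewrite -(setUv `]-oo, 0%R[%classic) setCitvl.
apply: le_lt_trans (measureU2 _ _ _) _; [exact: measurable_itv..|].
rewrite [X in (X + _)%E](mneg : _ = 0%E) add0e [X in (X < _)%E]m0.
exact: ltry.
Qed.

Theorem theorem3p3 (R : realType) (k : nat) (hk : (2 <= k)%N) (a : nat -> R)
    (mu nu : {measure set (measurableTypeR R) -> \bar R})
    (ha : determinate a) (hmu : representing_measure mu a)
    (hroot : Stieltjes_moment_sequence (fun n => a n `^ (k%:R^-1)))
    (hnu : representing_measure nu (fun n => a n `^ (k%:R^-1))) :
  supp mu = closure (@coord_prod R k @` @cartesian_power R k (supp nu)) /\
  (compact (supp nu) \/ ~ supp nu 0 ->
   supp mu = @coord_prod R k @` @cartesian_power R k (supp nu)).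
Proof.
have [[a0 _] uniq_a] := ha.
have k0 : k%:R != 0 :> R by rewrite pnatr_eq0 -lt0n; exact: leq_trans hk.
have [m nuE] := finite_measure_ex (representing_measure_lty hnu).
rewrite nuE in hnu *.
have mk : representing_measure (mulconv_exp m k) a.
  have := representing_mulconv_exp k hnu.
  under eq_fun do rewrite -powR_mulrn ?powR_ge0// -powRrM mulVf// powRr1//.
  by [].
have suppE : supp mu =
    closure (@coord_prod R k @` @cartesian_power R k (supp m)).
  rewrite -supp_mulconv_exp; apply: eq_supp => U oU.
  by apply: uniq_a => //; exact: open_measurable.
split=> //; rewrite suppE => hm; apply/esym/closure_id.
case: hm => [cm|m0].
  by apply: compact_closed => //; exact: compact_coord_prod.
have [d d0 md] : exists2 d : R, 0 < d & supp m `<=` [set x | d <= x].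
  have : nbhs (0 : R) (~` supp m).
    apply: open_nbhs_nbhs; split => //; apply: closed_openC.
    exact: closed_supp.
  move=> /nbhs_ballP[d /= d0 dm]; exists d => // x sx /=.
  rewrite leNgt; apply/negP => xd; apply: (dm x) => //.
  have /= x0 := (supp_nonneg m).1 hnu.1 x sx.
  by rewrite /ball /= sub0r normrN ger0_norm.
apply: closed_coord_prod d0 _ md; exact: closed_supp.
Qed.
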